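(* Let $G=(V,E)$ be a non-bipartite, finite, simple, connected graph with $n=|V|$ and maximum degree $d_{\max}$, and let $\lambda_1^A\le\lambda_2^A\le\dots\le\lambda_n^A$ be the eigenvalues of its adjacency matrix $A$. For $1\le k\le n$, $$d_{\max}+\lambda_k^A\ge\frac{k\,\mathscr K(G)}{n}\ge\frac{k}{(\mathrm{diam}(G)+1)\,n}.$$
   Context: Graphs are undirected and unweighted; $\mathrm{diam}(G)$ is the graph diameter. The graph parameter $\mathscr K(G)$ is $$\mathscr K(G):=\min\left\{\frac{\sum_{(v,u)\in E}|f(v)+f(u)|^2}{\max_{y\in V}|f(y)|^2}\ :\ f\colon V\to\mathbb R,\ \min_{y\in V}f(y)<0<\max_{y\in V}f(y)\right\},$$ where the sum counts each edge once. *)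

(* Defs.v *)
From mathcomp Require Import all_boot all_order all_algebra.
From mathcomp Require Import all_classical all_reals all_analysis.
Set Implicit Arguments.
Unset Strict Implicit.
Unset Printing Implicit Defensive.
Import Order.TTheory GRing.Theory Num.Theory.
Local Open Scope ring_scope.

Definition simple_graph (V : finType) (e : rel V) : Prop :=
  symmetric e /\ irreflexive e.

Definition connected_graph (V : finType) (e : rel V) : Prop :=
  forall x y : V, connect e x y.

Definition bipartite (V : finType) (e : rel V) : Prop :=
  exists c : V -> bool, forall x y : V, e x y -> c x != c y.

Definition max_degree (V : finType) (e : rel V) : nat :=
  (\max_(x : V) #|[pred y | e x y]|)%N.

(* Least length of a walk from x to y; the junk value #|V| when there is no
   walk. A shortest walk has distinct vertices, so lengths below #|V|
   suffice. *)
Definition gdist (V : finType) (e : rel V) (x y : V) : nat :=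
  find (fun k => [exists p : k.-tuple V, path e x p && (last x p == y)])
       (iota 0 #|V|).

Definition diam (V : finType) (e : rel V) : nat :=
  (\max_(x : V) \max_(y : V) gdist e x y)%N.

Definition adjacency_mx (R : realType) (V : finType) (e : rel V) :
    'M[R]_#|V| :=
  \matrix_(i, j) (e (enum_val i) (enum_val j))%:R.

Definition sorted_eigenvalues (R : realType) (n : nat) (A : 'M[R]_n)
    (s : seq R) : Prop :=
  sorted <=%R s /\ char_poly A = \prod_(a <- s) ('X - a%:P).

(* Edges are unordered pairs, so that a sum over them counts each edge once. *)
Definition edges (V : finType) (e : rel V) : {set {set V}} :=
  [set [set p.1; p.2]%SET | p : V * V & e p.1 p.2]%SET.

(* For an edge {v, u} with v != u, the inner sum is f v + f u. The default 0
   of the maximum is harmless since all the values are nonnegative. *)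
Definition K_quotient (R : realType) (V : finType) (e : rel V) (f : V -> R) :
    R :=
  (\sum_(uv in edges e) `|\sum_(w in uv) f w| ^+ 2)
    / (\big[Num.max/0]_(y : V) (`|f y| ^+ 2)).

(* The default value 0 of the two iterated operators does not affect the
   strict comparisons with 0. *)
Definition sign_changing (R : realType) (V : finType) (f : V -> R) : Prop :=
  \big[Num.min/0]_(y : V) f y < 0 < \big[Num.max/0]_(y : V) f y.

(* On a connected graph with at least two vertices this infimum is attained,
   hence is a minimum: normalise max |f| = 1 and take a minimiser over the
   closure of the sign-changing functions. If it were nonnegative and vanished
   somewhere, lowering it slightly at a zero with a nonzero neighbour would
   strictly decrease the energy; symmetrically if it were nonpositive. *)
Definition K_graph (R : realType) (V : finType) (e : rel V) : R :=
  inf [set K_quotient e f | f in [set f : V -> R | sign_changing f]%classic]%classic.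

(* Main.v *)
Require Import Defs.
From mathcomp Require Import all_boot all_order all_algebra.
From mathcomp Require Import all_classical all_reals all_analysis.
From mathcomp Require Import ring lra.
Import Order.TTheory GRing.Theory Num.Theory.
Local Open Scope ring_scope.

(** Let [E f] be the sum of [(f v + f u)^2] over the edges, that is the quadratic
    form of [D + A]. The projection onto the first [k] eigenvectors of [A] has
    trace [k], so some diagonal entry, at [v] say, is at least [k / n]; its
    column [f] at [v] satisfies [f v = |f|^2 >= k / n], while
    [E f <= (dmax + lambda_k) |f|^2]. Since [K (f v)^2 <= E f] for every [f],
    sign-changing or not, the first inequality follows on dividing by [f v].

    For the second one, let [y] be any vertex. As the graph is not bipartite,
    some vertex [v] is reached from [y] by two simple paths of opposite parities
    and lengths at most [diam + 1]. The alternating sums of [f a + f b] along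
    their edges are [f y + f v] and [f y - f v], one of which is at least
    [|f y|] in absolute value, and the Cauchy-Schwarz inequality gives
    [(f y)^2 <= (diam + 1) E f]. *)

Set Implicit Arguments.
Unset Strict Implicit.

(** * Orthogonal diagonalisation of symmetric matrices *)

Lemma row_norm_eq0 (R : realFieldType) (n : nat) (w : 'rV[R]_n) :
  ((w *m w^T) 0 0 == 0) = (w == 0).
Proof.
apply/idP/eqP => [|->]; last by rewrite mul0mx mxE.
rewrite mxE psumr_eq0 => [/allP w0|i _]; last by rewrite mxE -expr2 sqr_ge0.
apply/rowP => i; have := w0 i (mem_index_enum i).
by rewrite !mxE -expr2 sqrf_eq0 => /eqP.
Qed.

(** Prepares the deflation in [real_spectral]: when [u] is an eigenvector of a symmetric matrix,
    conjugation by [H] splits off its eigenvalue. *)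
Lemma orthogonal_completion (R : realFieldType) (n : nat) (u : 'rV[R]_n.+1) :
  u *m u^T = 1%:M ->
  exists2 H : 'M[R]_n.+1, H *m H^T = 1%:M & row 0 H = u.
Proof.
move=> u1; set e : 'rV[R]_n.+1 := delta_mx 0 0.
(* The reflection used below divides by |u - e|^2, so [u = e] is treated apart. *)
have [ue|ue] := eqVneq u e.
  by exists 1%:M; rewrite ?trmx1 ?mulmx1 // rowE mulmx1 ue.
(* The Householder reflection exchanging [u] and [e]. *)
set w := u - e; set c := (w *m w^T) 0 0.
have c0 : c != 0 by rewrite row_norm_eq0 subr_eq0.
have ee : e *m e^T = 1%:M.
  by rewrite trmx_delta mul_delta_mx; apply/matrixP => i j; rewrite !ord1 !mxE.
have wwc : w *m w^T = c%:M by rewrite [LHS]mx11_scalar.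
set t := (e *m u^T) 0 0.
have eu : e *m u^T = t%:M by rewrite [LHS]mx11_scalar.
have ue' : u *m e^T = t%:M by rewrite -[LHS]trmxK trmx_mul trmxK eu tr_scalar_mx.
have cE : c = 2 - 2 * t.
  rewrite /c /w linearB /= mulmxBl !mulmxBr u1 ee eu ue' !mxE /=; ring.
(* As [c = 2 - 2 * t], this reflection sends [e] to [e + w = u]. *)
exists (1%:M - (2 / c) *: (w^T *m w)); last first.
  rewrite rowE -/e mulmxBr mulmx1 -scalemxAr mulmxA.
  have -> : e *m w^T = (t - 1)%:M by rewrite linearB /= mulmxBr eu ee -raddfB.
  rewrite mul_scalar_mx scalerA.
  have -> : 2 / c * (t - 1) = -1.
    by have := c0; rewrite cE => c0'; field; rewrite cE in c0; exact: c0.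
  by rewrite scaleN1r opprK /w addrC subrK.
set M := w^T *m w; have MM : M *m M = c *: M.
  by rewrite /M mulmxA -(mulmxA _ w) wwc mul_mx_scalar -scalemxAl.
have -> : (1%:M - (2 / c) *: M)^T = 1%:M - (2 / c) *: M.
  by apply/matrixP => i j; rewrite !mxE eq_sym; do !congr (_ - _ * _);
     apply: eq_bigr => k _; rewrite !mxE mulrC.
rewrite mulmxBl !mulmxBr !mul1mx mulmx1 -scalemxAl -scalemxAr MM !scalerA.
have -> : 2 / c * (2 / c) * c = 2 / c *+ 2 by field.
by rewrite mulr2n scalerDl opprB addrK subrK.
Qed.

Lemma char_poly_orthogonal (R : comNzRingType) (n : nat) (H A : 'M[R]_n) :
  H *m H^T = 1%:M -> char_poly (H *m A *m H^T) = char_poly A.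
Proof.
move=> H1; rewrite /char_poly /char_poly_mx !map_mxM /=.
have HP : map_mx polyC H *m map_mx polyC H^T = 1%:M.
  by rewrite -map_mxM H1 map_mx1.
have -> : 'X%:M = map_mx polyC H *m 'X%:M *m map_mx polyC H^T.
  by rewrite mul_mx_scalar -scalemxAl HP scalemx1.
rewrite -mulmxBl -mulmxBr !det_mulmx mulrAC -det_mulmx HP det1 mul1r.
by rewrite mul_mx_scalar -scalemxAl HP scalemx1.
Qed.

Lemma char_poly_block_diag (R : comNzRingType) (m n : nat) (A : 'M[R]_m)
    (B : 'M[R]_n) :
  char_poly (block_mx A 0 0 B) = char_poly A * char_poly B.
Proof. by rewrite /char_poly char_block_diag_mx det_lblock. Qed.

(** Induction on [n]. The assumed splitting makes the head of [s] an eigenvalue; completing a unit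
    eigenvector to an orthogonal basis leaves, by symmetry, a block diagonal matrix whose lower
    block has the tail of [s] as spectrum. The diagonal thus keeps the order of [s]. *)
Lemma real_spectral (R : rcfType) (n : nat) (A : 'M[R]_n) (s : seq R) :
  A^T = A -> char_poly A = \prod_(a <- s) ('X - a%:P) ->
  exists2 P : 'M[R]_n, P *m P^T = 1%:M & P *m A *m P^T = diag_mx (\row_i s`_i).
Proof.
elim: n A s => [|n IHn] A s AT As.
  by exists 0; apply/matrixP => [[]].
have : size s = n.+1.
  by apply: succn_inj; rewrite -(size_char_poly A) As size_prod_XsubC.
case: s As => // a s As _.
have : eigenvalue A a.
  by rewrite eigenvalue_root_char As big_cons rootM root_XsubC eqxx.
case/eigenvalueP => v vA v0.
pose c : R := (v *m v^T) 0 0.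
have c_gt0 : 0 < c.
  rewrite lt_def row_norm_eq0 v0 /c mxE sumr_ge0 // => i _.
  by rewrite mxE -expr2 sqr_ge0.
pose u := (Num.sqrt c)^-1 *: v.
have u1 : u *m u^T = 1%:M.
  rewrite linearZ /= -scalemxAl -scalemxAr scalerA -expr2 exprVn sqr_sqrtr ?ltW //.
  by rewrite [_ *m _]mx11_scalar -/c scale_scalar_mx mulVf // gt_eqF.
have uA : u *m A = a *: u by rewrite -scalemxAl vA !scalerA mulrC.
have [H H1 Hu] := orthogonal_completion u1.
(* [B] is kept abstract and is typed with size [1 + n], the form that the block operations
   expect. *)
have [B BE] : exists B : 'M[R]_(1 + n), B = H *m A *m H^T by eexists.
have BT : B^T = B by rewrite BE !trmx_mul trmxK AT mulmxA.
have B0 j : B 0 j = a * (j == 0)%:R.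
  have : row 0 B = a *: delta_mx 0 0.
    rewrite BE -mulmxA row_mul Hu mulmxA uA -scalemxAl -Hu -row_mul H1.
    by rewrite rowE mulmx1.
  by move/rowP/(_ j); rewrite !mxE /=.
have l0 : lshift n 0 = 0 :> 'I_(1 + n) by apply: val_inj.
have Bur : ursubmx B = 0.
  by apply/matrixP => i j; rewrite ord1 !mxE l0 B0 mulr0.
have Bblock : B = block_mx a%:M 0 0 (drsubmx B).
  rewrite -[LHS]submxK Bur -[dlsubmx B]trmxK trmx_dlsub BT Bur trmx0.
  congr block_mx; apply/matrixP => i j.
  by rewrite !ord1 !mxE l0 B0 eqxx mulr1.
have Bs : char_poly (drsubmx B) = \prod_(a <- s) ('X - a%:P).
  apply: (@mulfI _ ('X - a%:P)); first by rewrite polyXsubC_eq0.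
  rewrite -[RHS](big_cons _ _ _ _ predT) -As -(char_poly_orthogonal A H1).
  rewrite -BE; apply: etrans (esym (_ : char_poly B = _)); last first.
    by rewrite {1}Bblock; exact: char_poly_block_diag.
  by rewrite [char_poly a%:M]det_mx11 !mxE.
have [|Q Q1 QB] := IHn (drsubmx B) s _ Bs.
  by rewrite trmx_drsub BT.
pose K : 'M[R]_(1 + n) := block_mx 1%:M 0 0 Q.
have KT : K^T = block_mx 1%:M 0 0 Q^T by rewrite tr_block_mx !trmx0 trmx1.
have K1 : K *m K^T = 1%:M.
  rewrite KT mulmx_block !mul0mx !mulmx0 Q1 !addr0 add0r mulmx1.
  by rewrite -scalar_mx_block.
have KB : K *m B *m K^T = diag_mx (\row_i (a :: s)`_i).
  rewrite KT Bblock !mulmx_block !mul0mx !mulmx0 !addr0 !mul0mx ?mulmx0.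
  rewrite ?mulmx0 ?add0r ?addr0 ?mul1mx ?mulmx1 QB.
  rewrite (_ : \row_i (a :: s)`_i = row_mx a%:M (\row_i s`_i)).
    by rewrite diag_mx_row; congr block_mx; apply/matrixP => i j; rewrite !ord1 !mxE.
  by apply/rowP => i; rewrite !mxE; case: split_ordP => j ->; rewrite !mxE ?ord1.
exists (K *m H); rewrite trmx_mul !mulmxA.
  by rewrite -(mulmxA K) H1 mulmx1.
by rewrite -KB BE !mulmxA.
Qed.

(** * A test vector from a spectral projection *)

Lemma localized_test_vector (R : rcfType) (n : nat) (A : 'M[R]_n) (s : seq R)
    (k : nat) :
  A^T = A -> char_poly A = \prod_(a <- s) ('X - a%:P) -> sorted <=%R s ->
  (0 < k <= n)%N ->
  exists (f : 'rV[R]_n) (v : 'I_n),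
    [/\ k%:R / n%:R <= f 0 v, (f *m f^T) 0 0 = f 0 v &
        (f *m A *m f^T) 0 0 <= s`_k.-1 * f 0 v].
Proof.
move=> AT As s_sorted /andP[k0 kn].
have ssz : size s = n.
  by apply: succn_inj; rewrite -(size_char_poly A) As size_prod_XsubC.
have [P P1 PA] := real_spectral AT As.
pose J : 'M[R]_n := diag_mx (\row_i (i < k)%:R).
pose F := P^T *m J *m P.
have JJ : J *m J = J.
  rewrite /J mulmx_diag; congr diag_mx; apply/rowP => i; rewrite !mxE.
  by case: (_ < _)%N; rewrite ?mulr1 ?mulr0.
have FT : F^T = F by rewrite /F !trmx_mul trmxK /J tr_diag_mx mulmxA.
have FF : F *m F^T = F.
  rewrite FT /F -!mulmxA (mulmxA P) P1 mul1mx (mulmxA J) JJ.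
  by [].
have diagE (d : 'rV[R]_n) v : (P^T *m diag_mx d *m P) v v = \sum_i d 0 i * P i v ^+ 2.
  rewrite mxE; apply: eq_bigr => i _; rewrite mul_mx_diag !mxE; ring.
have trF : \sum_v F v v = k%:R.
  rewrite -/(\tr F) /F -mulmxA mxtrace_mulC -mulmxA P1 mulmx1 mxtrace_diag.
  under eq_bigr do rewrite mxE.
  rewrite -natr_sum -[in RHS](card_ord k) -sum1_card; congr _%:R.
  rewrite (big_ord_widen n (fun=> 1%N) kn) [RHS]big_mkcond /=.
  by apply: eq_bigr => i _; case: (_ < _)%N.
have n0 : (0 < n)%N by apply: leq_trans kn.
have [v Fv] : exists v, k%:R / n%:R <= F v v.
  (* Averaging: if all diagonal entries were below [k / n], the trace would be below [k]. *)
  apply/existsP; rewrite -[X in is_true X]negbK negb_exists.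
  apply/negP => /forallP Fv.
  suff: \sum_v F v v < \sum_(v < n) k%:R / n%:R.
    rewrite trF sumr_const card_ord -[ltRHS]mulr_natr divfK ?ltxx //.
    by rewrite pnatr_eq0 -lt0n.
  apply: ltr_sum => [|i _]; last by have := Fv i; rewrite -ltNge.
  by apply/hasP; exists (Ordinal n0); rewrite ?mem_index_enum.
exists (row v F), v.
have rowF (B : 'M[R]_n) : (row v F *m B *m (row v F)^T) 0 0 = (F *m B *m F^T) v v.
  by rewrite -!row_mul tr_row colE mulmxA -colE !mxE.
split.
- by rewrite mxE.
- by have := rowF 1%:M; rewrite !mulmx1 FF => ->; rewrite [RHS]mxE.
rewrite rowF FT [row v F 0 v]mxE.
(* In the eigenbasis both [A] and the projection are diagonal, so the two sides become sums weighted
   by the squares [P i v ^+ 2]. *)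
have -> : F *m A *m F = P^T *m diag_mx (\row_i ((i < k)%:R * s`_i)) *m P.
  rewrite /F -!mulmxA; congr (_ *m _); rewrite !mulmxA; congr (_ *m _).
  rewrite -!(mulmxA J) PA /J !mulmx_diag; congr diag_mx; apply/rowP => i.
  by rewrite !mxE; case: (_ < _)%N; rewrite ?mul1r ?mulr1 ?mul0r.
rewrite /F !diagE mulr_sumr; apply: ler_sum => i _; rewrite !mxE mulrA.
case: ltnP => ik; last by rewrite !(mul0r, mulr0).
rewrite mul1r mulr1 ler_wpM2r ?sqr_ge0 //.
apply: (sorted_leq_nth le_trans le_refl) => //; rewrite ?inE ?ssz.
- exact: leq_trans ik kn.
- by rewrite prednK.
- by rewrite -ltnS prednK.
Qed.

(** * The energy as a quadratic form *)

Definition energy (R : realType) (V : finType) (e : rel V) (f : V -> R) : R :=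
  \sum_(uv in edges e) `|\sum_(w in uv) f w| ^+ 2.

Lemma energy_ge0 (R : realType) (V : finType) (e : rel V) (f : V -> R) :
  0 <= energy e f.
Proof. by apply: sumr_ge0 => A _; rewrite exprn_ge0. Qed.

Lemma sum_set2 (R : nmodType) (V : finType) (f : V -> R) (a b : V) :
  a != b -> \sum_(w in [set a; b]%SET) f w = f a + f b.
Proof. by move=> ab; rewrite big_setU1 ?big_set1 // inE. Qed.

Lemma mem_edges (V : finType) (e : rel V) (a b : V) :
  e a b -> [set a; b]%SET \in edges e.
Proof. by move=> ab; apply/imsetP; exists (a, b); rewrite ?inE. Qed.

Lemma eq_set2 (V : finType) (a b c d : V) :
  ([set a; b] == [set c; d])%SET = ((a, b) == (c, d)) || ((a, b) == (d, c)).
Proof.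
rewrite !xpair_eqE; apply/eqP/idP => [ab|]; last first.
  by case/orP=> /andP[/eqP -> /eqP ->] //; rewrite finset.setUC.
have : a \in [set c; d]%SET by rewrite -ab set21.
have : b \in [set c; d]%SET by rewrite -ab set22.
have : c \in [set a; b]%SET by rewrite ab set21.
have : d \in [set a; b]%SET by rewrite ab set22.
rewrite !inE (eq_sym c a) (eq_sym c b) (eq_sym d a) (eq_sym d b).
by case: (a == c); case: (b == c); case: (a == d); case: (b == d).
Qed.

(** Each edge comes from exactly two ordered pairs, distinct because there are no loops; hence the
    factor 2. *)
Lemma energy_pairs (R : realType) (V : finType) (e : rel V) (f : V -> R) :
  simple_graph e ->
  2 * energy e f = \sum_x \sum_y (e x y)%:R * (f x + f y) ^+ 2.
Proof.
move=> [sym irr]; rewrite pair_big /=.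
rewrite [RHS](_ : _ = \sum_(p | e p.1 p.2) (f p.1 + f p.2) ^+ 2); last first.
  by rewrite [RHS]big_mkcond; apply: eq_bigr => p _; case: (e _ _); rewrite ?mul1r ?mul0r.
rewrite (partition_big (fun p => [set p.1; p.2]%SET) (mem (edges e))) /=; last first.
  by move=> [a b] /=; exact: mem_edges.
rewrite mulr_sumr; apply: eq_bigr => A /imsetP[[a b]]; rewrite inE /= => ab ->.
have ba : a != b by apply: contraTneq ab => ->; rewrite irr.
rewrite sum_set2 // (bigD1 (a, b)) ?ab ?eqxx //= (bigD1 (b, a)) /=; last first.
  by rewrite sym ab eq_set2 eqxx orbT xpair_eqE negb_and eq_sym ba.
rewrite big1; last first.
  move=> [c d] /=.
  by rewrite eq_set2; do 2![case: (_ == _)]; rewrite ?andbF.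
rewrite real_normK ?num_real //; ring.
Qed.

Lemma energy_quadratic (R : realType) (V : finType) (e : rel V) (f : V -> R) :
  simple_graph e ->
  energy e f = \sum_x #|[pred y | e x y]|%:R * f x ^+ 2 +
                   \sum_x \sum_y (e x y)%:R * f x * f y.
Proof.
move=> se; set S := \sum_x _ * _; set T := \sum_x \sum_y _.
apply: (@mulfI _ 2) => //; rewrite energy_pairs //.
have deg x : #|[pred y | e x y]|%:R * f x ^+ 2 = \sum_y (e x y)%:R * f x ^+ 2.
  rewrite -mulr_suml -natr_sum -sum1_card big_mkcond /=.
  by congr (_%:R * _); apply: eq_bigr => y _; rewrite inE; case: (e x y).
have S1 : \sum_x \sum_y (e x y)%:R * f x ^+ 2 = S.
  by apply: eq_bigr => x _; rewrite deg.
have S2 : \sum_x \sum_y (e x y)%:R * f y ^+ 2 = S.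
  rewrite -S1 exchange_big; apply: eq_bigr => x _; apply: eq_bigr => y _.
  by rewrite (proj1 se).
rewrite (_ : 2 * (S + T) = S + 2 * T + S); last by ring.
rewrite -{1}S1 -S2 /T mulr_sumr -!big_split /=; apply: eq_bigr => x _.
rewrite mulr_sumr -!big_split /=; apply: eq_bigr => y _; ring.
Qed.

(** * Bounding the energy below by the graph parameter *)

Lemma sign_changingP (R : realType) (V : finType) (f : V -> R) :
  sign_changing f <-> (exists y, f y < 0) /\ (exists y, 0 < f y).
Proof.
split=> [/andP[/bigmin_ltP fneg fpos]|[[y fy] [z fz]]]; last first.
  rewrite /sign_changing (le_lt_trans (bigmin_le _ y _)) //=.
  exact: lt_le_trans (le_bigmax _ _ z).
split; first by case: fneg => [|[y _ ?]]; rewrite ?ltxx; last exists y.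
apply/not_existsP => fnpos; suff: \big[Num.max/0]_y f y <= 0 by rewrite leNgt fpos.
by apply: bigmax_le => // y _; rewrite leNgt; apply/negP/fnpos.
Qed.

Lemma K_quotient_ge0 (R : realType) (V : finType) (e : rel V) (f : V -> R) :
  0 <= K_quotient e f.
Proof. by apply: divr_ge0; [exact: energy_ge0 | exact: bigmax_ge_id]. Qed.

Lemma exists_sign_changing (R : realType) (V : finType) (y u : V) :
  y != u -> exists f : V -> R, sign_changing f.
Proof.
move=> yu; exists (fun x => (x == y)%:R - (x == u)%:R).
apply/sign_changingP; split; [exists u | exists y];
  by rewrite eqxx ?(negPf yu) 1?eq_sym ?(negPf yu) ?sub0r ?subr0 ?oppr_lt0 ltr01.
Qed.

Lemma K_graph_ge0 (R : realType) (V : finType) (e : rel V) :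
  (exists f : V -> R, sign_changing f) -> 0 <= K_graph R e.
Proof.
move=> [f sf]; apply: lb_le_inf; first by exists (K_quotient e f), f.
by move=> _ [g _ <-]; exact: K_quotient_ge0.
Qed.

(** The infimum is at most the quotient of [f]; since it is nonnegative, the maximum of [f ^+ 2] may
    be replaced by any single value. *)
Lemma K_graph_le_sign_changing (R : realType) (V : finType) (e : rel V)
    (f : V -> R) (y : V) :
  sign_changing f -> K_graph R e * f y ^+ 2 <= energy e f.
Proof.
move=> sf; have /sign_changingP[_ [z fz]] := sf.
set M := \big[Num.max/0]_(y : V) (`|f y| ^+ 2).
have le_M w : f w ^+ 2 <= M.
  by rewrite -real_normK ?num_real //; exact: (le_bigmax _ (fun y => `|f y| ^+ 2)).
have M0 : 0 < M by apply: lt_le_trans (le_M z); rewrite exprn_gt0.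
have K0 : 0 <= K_graph R e by apply: K_graph_ge0; exists f.
apply: le_trans (ler_wpM2l K0 (le_M y)) _.
rewrite -ler_pdivlMr //; apply: ge_inf; last by exists f.
by exists 0 => _ [g _ <-]; exact: K_quotient_ge0.
Qed.

(* When f has constant sign, flip the sign at a vertex z != y of its support;
   when the support is {y}, perturb f at a neighbour of y instead. *)
Lemma K_graph_le (R : realType) (V : finType) (e : rel V) (f : V -> R) (y : V) :
  simple_graph e -> (exists u, e y u) ->
  K_graph R e * f y ^+ 2 <= energy e f.
Proof.
move=> se [u yu]; have [sym irr] := se.
have yNu : y != u by apply: contraTneq yu => ->; rewrite irr.
have K0 : 0 <= K_graph R e.
  exact: K_graph_ge0 (exists_sign_changing R yNu).
(* Both sides are unchanged when [f] is replaced by [- f]. *)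
wlog fy : f / 0 < f y => [thm|].
  have [fy|fy|->] := ltgtP (f y) 0; last first.
  - by rewrite expr0n mulr0 energy_ge0.
  - exact: thm.
  have := thm (fun x => - f x); rewrite oppr_gt0 sqrrN => /(_ fy).
  rewrite /energy; under [X in _ <= X -> _]eq_bigr do rewrite sumrN normrN.
  by [].
have [[z fz]|/forallNP fge0] := pselect (exists z, f z < 0).
  by apply: K_graph_le_sign_changing; apply/sign_changingP; split; [exists z | exists y].
have {}fge0 x : 0 <= f x by rewrite leNgt; apply/negP/fge0.
have [[z [zy fz]]|fsupp] := pselect (exists z, z != y /\ f z != 0).
  pose g x := if x == z then - f x else f x.
  have gy : g y = f y by rewrite /g eq_sym (negPf zy).
  rewrite -gy; apply: le_trans (_ : energy e g <= _).
    apply: K_graph_le_sign_changing; apply/sign_changingP.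
    split; last by exists y; rewrite gy.
    by exists z; rewrite /g eqxx oppr_lt0 lt_def fz fge0.
  (* On each edge |sum of g| <= sum of |g| = sum of f, as [f] is nonnegative. *)
  apply: ler_sum => A _; rewrite ler_pXn2r ?nnegrE //.
  apply: le_trans (ler_norm_sum _ _ _) _; rewrite ger0_norm ?sumr_ge0 //.
  by apply: ler_sum => x _; rewrite /g; case: ifP; rewrite ?normrN ger0_norm.
have {}fsupp x : f x = f y * (x == y)%:R.
  have [->|xy] := eqVneq x y; first by rewrite mulr1.
  by rewrite mulr0; apply/eqP/negPn/negP => fx; apply: fsupp; exists x.
have efy : energy e f = #|[pred w | e y w]|%:R * f y ^+ 2.
  rewrite energy_quadratic // [X in _ + X]big1 => [|x _].
    rewrite addr0 (bigD1 y) //= big1 ?addr0 // => x /negPf xy.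
    by rewrite fsupp xy mulr0 expr0n mulr0.
  apply: big1 => w _; rewrite (fsupp x) (fsupp w).
  have [->|] := eqVneq x y; last by rewrite !(mulr0, mul0r).
  by have [->|] := eqVneq w y; rewrite ?irr !(mulr0, mul0r).
pose d : R := #|[pred w | e u w]|%:R.
have d0 : 0 < d.
  by rewrite ltr0n; apply/card_gt0P; exists y; rewrite inE sym.
(* The value [- f y / d] at [u] minimises the energy among functions equal to [f y] at [y] and zero
   off [y] and [u]; it lowers the energy by [f y ^+ 2 / d]. *)
pose g x := f y * ((x == y)%:R - d^-1 * (x == u)%:R).
have gy : g y = f y by rewrite /g eqxx (negPf yNu) mulr0 subr0 mulr1.
have gu : g u = - (f y / d) by rewrite /g eqxx eq_sym (negPf yNu) sub0r mulr1 mulrN.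
have g0 x : x != y -> x != u -> g x = 0.
  by move=> /negPf xy /negPf xu; rewrite /g xy xu mulr0 subr0 mulr0.
rewrite -gy; apply: le_trans (_ : energy e g <= _).
  apply: K_graph_le_sign_changing; apply/sign_changingP.
  by split; [exists u; rewrite gu oppr_lt0 divr_gt0 | exists y; rewrite gy].
have sum2 (F : V -> R) :
    (forall x, x != y -> x != u -> F x = 0) -> \sum_x F x = F y + F u.
  move=> F0; rewrite (bigD1 y) //= (bigD1 u) 1?eq_sym //= big1 ?addr0 //.
  by move=> x /andP[? ?]; exact: F0.
rewrite efy energy_quadratic // !sum2;
  try by move=> x xy xu; rewrite (g0 x) // ?expr0n ?mulr0.
  rewrite gy gu -/d !irr yu sym yu /=.
  have -> : d * (- (f y / d)) ^+ 2 = f y ^+ 2 / d by field; rewrite gt_eqF.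
  rewrite -subr_ge0.
  set X := (X in 0 <= X).
  have -> : X = f y ^+ 2 / d by rewrite /X; field; rewrite gt_eqF.
  by rewrite divr_ge0 ?sqr_ge0 // ltW.
by move=> x xy xu; apply: big1 => w _; rewrite (g0 x) // mulr0 mul0r.
Qed.

(** * Energy along simple paths *)

Definition path_edges (V : finType) (x : V) (p : seq V) : seq {set V} :=
  pairmap (fun a b => [set a; b]%SET) x p.

Lemma path_edges_sub (V : finType) (e : rel V) (x : V) (p : seq V) :
  path e x p -> {subset path_edges x p <= edges e}.
Proof.
elim: p x => //= y p IHp x /andP[xy yp] A; rewrite inE => /predU1P[->|].
  exact: mem_edges.
exact: IHp yp A.
Qed.

Lemma path_edges_incl (V : finType) (x y : V) (p : seq V) (A : {set V}) :
  A \in path_edges x p -> y \in A -> y \in x :: p.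
Proof.
elim: p x => //= z p IHp x; rewrite inE => /predU1P[->|Ap yA].
  by rewrite !inE orbA => ->.
by rewrite inE (IHp z Ap yA) orbT.
Qed.

(** The first edge contains [x], which lies on no later edge of a simple path. *)
Lemma path_edges_uniq (V : finType) (x : V) (p : seq V) :
  uniq (x :: p) -> uniq (path_edges x p).
Proof.
elim: p x => //= y p IHp x /andP[xp /IHp ->]; rewrite andbT.
by apply: contra xp => /path_edges_incl; apply; rewrite set21.
Qed.

(** Cauchy-Schwarz against the constant vector 1. Adding a term [F i] increases the gap between the
    two sides by the sum of the squares [(F i - F j) ^+ 2]. *)
Lemma sum_sqr_le (R : realFieldType) (I : Type) (r : seq I) (F : I -> R) :
  (\sum_(i <- r) F i) ^+ 2 <= (size r)%:R * \sum_(i <- r) F i ^+ 2.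
Proof.
elim: r => [|i r IHr]; first by rewrite !big_nil expr0n mul0r.
have : 0 <= \sum_(j <- r) (F i - F j) ^+ 2 by apply: sumr_ge0 => j _; exact: sqr_ge0.
have -> : \sum_(j <- r) (F i - F j) ^+ 2 =
    (size r)%:R * F i ^+ 2 - 2 * F i * (\sum_(j <- r) F j) + \sum_(j <- r) F j ^+ 2.
  elim: (r) => [|j r' IHr']; first by rewrite !big_nil mul0r mulr0 subr0 addr0.
  by rewrite !big_cons IHr' /= -natr1; ring.
by rewrite !big_cons /= -natr1; nra.
Qed.

Lemma path_alternating_sum (R : realType) (V : finType) (f : V -> R) (x : V)
    (p : seq V) :
  uniq (x :: p) ->
  `|f x - (-1) ^+ size p * f (last x p)| <=
    \sum_(A <- path_edges x p) `|\sum_(w in A) f w|.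
Proof.
elim: p x => [|y p IHp] x; first by rewrite expr0 mul1r subrr normr0 big_nil.
rewrite /= => /andP[xp yp]; rewrite big_cons.
rewrite sum_set2; last by move: xp; rewrite inE negb_or => /andP[].
rewrite exprS (_ : _ - _ = (f x + f y) - (f y - (-1) ^+ size p * f (last y p))).
  by apply: le_trans (ler_normB _ _) _; rewrite lerD2l IHp.
ring.
Qed.

Lemma energy_path (R : realType) (V : finType) (e : rel V) (f : V -> R) (x : V)
    (p : seq V) :
  path e x p -> uniq (x :: p) ->
  (f x - (-1) ^+ size p * f (last x p)) ^+ 2 <= (size p)%:R * energy e f.
Proof.
move=> xp up; rewrite -real_normK ?num_real //.
apply: (@le_trans _ _ ((\sum_(A <- path_edges x p) `|\sum_(w in A) f w|) ^+ 2)).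
  rewrite ler_pXn2r ?nnegrE ?sumr_ge0 //; exact: path_alternating_sum.
apply: le_trans (sum_sqr_le _ _) _; rewrite size_pairmap.
(* The edges of the path being distinct, their sum is a partial sum of the energy. *)
rewrite ler_wpM2l // (big_uniq _ (path_edges_uniq up)) /=.
rewrite [leLHS]big_mkcond [leRHS]big_mkcond; apply: ler_sum => A _.
have /(_ A) := path_edges_sub xp.
by case: (A \in path_edges x p) => [/(_ isT) ->|_] //; case: ifP; rewrite ?exprn_ge0.
Qed.

(** * Distances and paths of opposite parities *)

Lemma walk_tuple (V : finType) (e : rel V) (x y : V) (p : seq V) :
  path e x p -> last x p = y ->
  [exists p' : (size p).-tuple V, path e x p' && (last x p' == y)].
Proof. by move=> xp py; apply/existsP; exists (in_tuple p); rewrite xp py eqxx. Qed.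

Lemma gdist_le (V : finType) (e : rel V) (x y : V) (p : seq V) :
  path e x p -> last x p = y -> (gdist e x y <= size p)%N.
Proof.
move=> xp py; rewrite leqNgt; apply/negP => lt_p.
have /negbT/negP[] := before_find 0%N lt_p.
rewrite nth_iota ?add0n; first exact: walk_tuple.
by apply: leq_trans lt_p _; rewrite -[leqRHS](size_iota 0) find_size.
Qed.

(** A simple path has fewer than [#|V|] edges, so the search defining [gdist] succeeds. The walk it
    finds, once shortened to a simple path, cannot lose length by [gdist_le]. *)
Lemma gdist_path (V : finType) (e : rel V) (x y : V) :
  connect e x y ->
  exists p, [/\ path e x p, last x p = y, uniq (x :: p) & size p = gdist e x y].
Proof.
case/connectP => p0 /shortenP[p xp up _] yE.
have szp : (size p < #|V|)%N by have := max_card (mem (x :: p)); rewrite (card_uniqP up).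
have := walk_tuple xp (esym yE).
set P := fun k => [exists p' : k.-tuple V, path e x p' && (last x p' == y)].
move=> Pp; have hasP : has P (iota 0 #|V|).
  by apply/hasP; exists (size p); rewrite ?mem_iota.
have ltV : (gdist e x y < #|V|)%N by rewrite -[ltnRHS](size_iota 0) -has_find.
have := nth_find 0%N hasP; rewrite -/(gdist e x y).
rewrite nth_iota // add0n => /existsP[q0 /andP[]].
case/shortenP => q xq uq qq0 /eqP ql; exists q; split=> //.
apply/eqP; rewrite eqn_leq gdist_le // andbT.
rewrite -[leqRHS](size_tuple q0); apply: uniq_leq_size qq0.
by case/andP: uq.
Qed.

Lemma gdist_le_diam (V : finType) (e : rel V) (x y : V) :
  (gdist e x y <= diam e)%N.
Proof.
apply: leq_trans (leq_bigmax x).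
exact: (leq_bigmax (F := fun y => gdist e x y)).
Qed.

(* Some edge u v joins vertices at distances of equal parity from x. Extending
   a shortest path to u by v gives a path to v whose length has the other
   parity than a shortest path to v. *)
Lemma odd_detour (V : finType) (e : rel V) (x : V) :
  simple_graph e -> connected_graph e -> ~ bipartite e ->
  exists p q, [/\ path e x p /\ uniq (x :: p), path e x q /\ uniq (x :: q),
    last x p = last x q, odd (size p) != odd (size q) &
    (size p <= diam e + 1)%N /\ (size q <= diam e + 1)%N].
Proof.
move=> [sym irr] conn nb.
have [u [v [uv par le_uv]]] : exists u v, [/\ e u v,
    odd (gdist e x u) = odd (gdist e x v) & (gdist e x u <= gdist e x v)%N].
  (* Otherwise the parity of the distance from [x] is a proper 2-colouring. *)
  apply: contrapT => H; apply: nb; exists (fun y => odd (gdist e x y)) => u v uv.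
  apply/negP => /eqP par; apply: H.
  have [le|/ltnW le] := leqP (gdist e x u) (gdist e x v).
    by exists u, v.
  by exists v, u; rewrite sym.
have [p [xp pu up szp]] := gdist_path (conn x u).
have [q [xq qv uq szq]] := gdist_path (conn x v).
exists (rcons p v), q; split.
- split; first by rewrite rcons_path xp pu.
  rewrite -rcons_cons rcons_uniq up andbT; apply/negP => vp.
  have vu : v != u by apply: contraTneq uv => ->; rewrite irr.
  (* If [v] were on the path to [u], the part up to [v] would be at least as long as the whole path,
     since [v] is no nearer than [u]; then [v = u], which makes a loop. *)
  case/splitPl: p / vp xp pu szp up => p1 p2 p1v.
  rewrite cat_path last_cat size_cat => /andP[xp1 _] pu szp _.
  have le_p1 := leq_trans le_uv (gdist_le xp1 p1v).
  have /size0nil p20 : size p2 = 0%N.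
    by apply/eqP; rewrite -leqn0 -(leq_add2l (size p1)) addn0 szp.
  by move: pu vu; rewrite p20 /= p1v => ->; rewrite eqxx.
- by [].
- by rewrite last_rcons.
- by rewrite size_rcons /= szp szq par; case: odd.
- by rewrite size_rcons szp szq addn1 ltnS !leqW ?gdist_le_diam.
Qed.

Lemma energy_ge (R : realType) (V : finType) (e : rel V) (f : V -> R) (x : V) :
  simple_graph e -> connected_graph e -> ~ bipartite e ->
  f x ^+ 2 <= (diam e + 1)%:R * energy e f.
Proof.
move=> se conn nb.
have [p [q [[xp up] [xq uq] pq par [szp szq]]]] := odd_detour x se conn nb.
have E0 := energy_ge0 e f.
have key r : path e x r -> uniq (x :: r) -> (size r <= diam e + 1)%N ->
    (f x - (-1) ^+ size r * f (last x r)) ^+ 2 <= (diam e + 1)%:R * energy e f.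
  move=> xr ur szr; apply: le_trans (energy_path f xr ur) _.
  by rewrite ler_wpM2r ?ler_nat.
have := key p xp up szp; have := key q xq uq szq; rewrite pq.
move: par; rewrite -[(-1) ^+ size p]signr_odd -[(-1) ^+ size q]signr_odd.
set a := f x; set b := f _; set M := _%:R * _.
(* Hidden by nothing but the parities, the two bounds are on [(a - b) ^+ 2] and [(a + b) ^+ 2]; half
   their sum is [a ^+ 2 + b ^+ 2 <= M]. *)
by case: (odd (size p)); case: (odd (size q)); rewrite //= ?expr0 ?expr1 => _; nra.
Qed.

Unset Implicit Arguments.
Set Strict Implicit.

Theorem proposition1p8 (R : realType) (V : finType) (e : rel V)
    (e_simple : simple_graph e) (e_connected : connected_graph e)
    (e_nonbipartite : ~ bipartite e)
    (lambda : seq R)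
    (lambdaE : sorted_eigenvalues (adjacency_mx R e) lambda)
    (k : nat) (k_range : (1 <= k <= #|V|)%N) :
  (max_degree e)%:R + lambda`_k.-1 >= k%:R * K_graph R e / #|V|%:R /\
  k%:R * K_graph R e / #|V|%:R >= k%:R / ((diam e + 1)%:R * #|V|%:R).
Proof.
have [/andP[k0 kn] [sym irr]] := (k_range, e_simple).
have n0 : (0 < #|V|)%N by exact: leq_trans kn.
(* Without edges, a constant colouring would make the graph bipartite. *)
have [y0 [u0 yu0]] : exists y u, e y u.
  apply: contrapT => H; apply: e_nonbipartite; exists (fun=> true) => y u yu.
  by case: H; exists y, u.
have yNu0 : y0 != u0 by apply: contraTneq yu0 => ->; rewrite irr.
have deg x : exists u, e x u.
  have [<-|xy] := eqVneq y0 x; first by exists u0.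
  case/connectP: (e_connected x y0) xy => [[|z p]] /= => [_ ->|/andP[xz _] _ _].
    by rewrite eqxx.
  by exists z.
split; last first.
  (* It remains to bound every quotient below by the inverse of [diam e + 1]; [energy_ge] is applied
     at every vertex to reach the maximum. *)
  rewrite invfM mulrA -!mulrA ler_wpM2l ?ler0n // ler_wpM2r ?invr_ge0 ?ler0n //.
  have [f sf] := exists_sign_changing R yNu0.
  apply: lb_le_inf; first by exists (K_quotient e f), f.
  move=> _ [g /sign_changingP[_ [z gz]] <-].
  have le_M : \big[Num.max/0]_(y : V) (`|g y| ^+ 2) <= (diam e + 1)%:R * energy e g.
    apply: bigmax_le => [|y _]; first by rewrite mulr_ge0 ?energy_ge0.
    by rewrite real_normK ?num_real // energy_ge.
  have M0 : 0 < \big[Num.max/0]_(y : V) (`|g y| ^+ 2).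
    apply: lt_le_trans (le_bigmax _ (fun y => `|g y| ^+ 2) z).
    by rewrite exprn_gt0 // normr_gt0 gt_eqF.
  by rewrite /K_quotient ler_pdivlMr // ler_pdivrMl // ltr0n addn1.
case: lambdaE => s_sorted s_char.
have AT : (adjacency_mx R e)^T = adjacency_mx R e.
  by apply/matrixP => i j; rewrite !mxE sym.
have [f [v [fv ff fAf]]] := localized_test_vector AT s_char s_sorted k_range.
(* The test vector is carried from matrix indices to vertices. *)
pose g x := f 0 (enum_rank x).
have sumV (F : V -> R) : \sum_x F x = \sum_(i < #|V|) F (enum_val i).
  by rewrite (reindex _ (onW_bij _ (enum_val_bij V))).
have f0 : 0 < f 0 v by apply: lt_le_trans fv; rewrite divr_gt0 ?ltr0n.
have gg : \sum_x g x ^+ 2 = f 0 v.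
  by rewrite sumV -ff mxE; apply: eq_bigr => i _; rewrite mxE /g enum_valK expr2.
have gAg : \sum_x \sum_y (e x y)%:R * g x * g y <= lambda`_k.-1 * f 0 v.
  apply: le_trans fAf; rewrite sumV mxE le_eqVlt; apply/orP; left; apply/eqP.
  under eq_bigr do rewrite sumV.
  rewrite exchange_big; apply: eq_bigr => i _; rewrite !mxE mulr_suml.
  by apply: eq_bigr => j _; rewrite !mxE /g !enum_valK; ring.
have gE : energy e g <= ((max_degree e)%:R + lambda`_k.-1) * f 0 v.
  rewrite energy_quadratic // mulrDl lerD // -gg mulr_sumr; apply: ler_sum => x _.
  rewrite ler_wpM2r ?sqr_ge0 // ler_nat.
  exact: (leq_bigmax (F := fun x => #|[pred y | e x y]|)).
have Kg := K_graph_le g e_simple (deg (enum_val v)).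
have K0 := K_graph_ge0 e (exists_sign_changing R yNu0).
(* First [k / n <= f 0 v] is used; the remaining comparison is multiplied by [f 0 v > 0] to meet the
   bounds [Kg] and [gE]. *)
apply: (@le_trans _ _ (K_graph R e * f 0 v)).
  by rewrite mulrAC mulrC ler_wpM2l.
rewrite -(ler_pM2r f0) -mulrA -expr2; apply: le_trans gE.
by move: Kg; rewrite /g enum_valK.
Qed.
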